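(* Let $n\in\mathbb{N}$, $n\ge 3$, and write $n=3m+r$ with $m\in\mathbb{N}$, $r\in\{0,1,2\}$. Then the spectrum of $T_n(a)$ is contained in $\Lambda(a)$ and is invariant under $2\pi/3$-rotations around the origin. More precisely, each one of the three open intervals $\varepsilon_3^p\,(0,L)$, where $p\in\{0,1,2\}$, contains exactly $m$ simple eigenvalues of $T_n(a)$. If $n$ is not a multiple of $3$, then $0$ is an eigenvalue of $T_n(a)$ of algebraic multiplicity $r$ and geometric multiplicity $1$.
   Context: $a(t)=t^{-1}+t^2$. $T_n(a)=[a_{j-k}]_{j,k=1}^n$ is the $n\times n$ Toeplitz matrix with $a_{-1}=a_2=1$ and $a_q=0$ for all other integers $q$; i.e. the $(j,k)$ entry is $1$ if $k=j+1$ or $k=j-2$, and $0$ otherwise. $L=3/\sqrt[3]{4}$, $\varepsilon_3=e^{2\pi \mathrm{i}/3}$, and $\Lambda(a)=[0,L]\cup(\varepsilon_3[0,L])\cup(\varepsilon_3^2[0,L])\subset\mathbb{C}$. For $z\in\mathbb{C}$ and $S\subseteq\mathbb{C}$, $zS=\{zs: s\in S\}$. *)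

(* Defs.v *)
From HB Require Import structures.
From mathcomp Require Import all_boot all_order all_algebra.
From mathcomp Require Import all_classical all_reals all_analysis.
From mathcomp Require Import complex.

Set Implicit Arguments.
Unset Strict Implicit.
Unset Printing Implicit Defensive.

Import Order.TTheory GRing.Theory Num.Theory.

Local Open Scope classical_set_scope.
Local Open Scope ring_scope.
Local Open Scope complex_scope.

(* Row and column indices start at 0; only their difference matters. *)
Definition toeplitz (F : Type) (a : int -> F) (n : nat) : 'M[F]_n :=
  \matrix_(j < n, k < n) a (j%:Z - k%:Z).

(* The Laurent coefficients of the symbol a(t) = t^-1 + t^2. *)
Definition acoef (R : realType) (q : int) : R[i] :=
  if (q == -1) || (q == 2) then 1 else 0.

Definition Ta (R : realType) (n : nat) : 'M[R[i]]_n := toeplitz (acoef R) n.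

Definition spectrum (F : fieldType) (n : nat) (A : 'M[F]_n) : set F :=
  [set z | eigenvalue A z].

Definition algmult (F : fieldType) (n : nat) (A : 'M[F]_n) (z : F) : nat :=
  mup z (char_poly A).

(* [eigenspace A z] is the kernel of A - z acting on row vectors; its dimension
   n - rank (A - z) is also that of the kernel on column vectors. *)
Definition geomult (F : fieldType) (n : nat) (A : 'M[F]_n) (z : F) : nat :=
  \rank (eigenspace A z).

(* e^(i theta) *)
Definition cexpi (R : realType) (theta : R) : R[i] := cos theta +i* sin theta.

Definition eps3 (R : realType) : R[i] := cexpi (2 * pi / 3).

Definition Lend (R : realType) : R := 3 / (4 `^ (3^-1)).

Definition zset (R : realType) (z : R[i]) (S : set R[i]) : set R[i] :=
  [set z * s | s in S].

Definition cclosed_seg (R : realType) : set R[i] :=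
  [set x%:C | x in `[0, Lend R]].

Definition copen_seg (R : realType) : set R[i] :=
  [set x%:C | x in `]0, Lend R[].

Arguments cclosed_seg R : clear implicits.
Arguments copen_seg R : clear implicits.

Definition Lambda (R : realType) : set R[i] :=
  cclosed_seg R `|` zset (eps3 R) (cclosed_seg R)
    `|` zset (eps3 R ^+ 2) (cclosed_seg R).

Arguments Lambda R : clear implicits.

(* Main.v *)
Require Import Defs.
From HB Require Import structures.
From mathcomp Require Import all_boot all_order all_algebra.
From mathcomp Require Import all_classical all_reals all_analysis.
From mathcomp Require Import complex polyrcf zify ring lra.

Set Implicit Arguments.
Unset Strict Implicit.
Unset Printing Implicit Defensive.

Import Order.TTheory GRing.Theory Num.Theory.

Local Open Scope classical_set_scope.
Local Open Scope card_scope.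
Local Open Scope ring_scope.

(* Expanding the determinant shows that the characteristic polynomials satisfy
   chi_(n+3) = x chi_(n+2) - chi_n, so that chi_n = x^(n mod 3) q_n(x^3) with
   q_n monic of degree n / 3.  The roots of q_(n+2), q_(n+1), q_n interlace
   cyclically in (0, 27/4), where 27/4 = L^3: at consecutive points of the
   merged sequence of roots the recurrence gives q_(n+3) opposite signs, so it
   acquires one root in each gap just above a root of q_(n+2), and the pattern
   reproduces itself.  Each root s^3 of q_n yields the three simple eigenvalues
   s, eps s, eps^2 s, and the factor x^(n mod 3) accounts for 0. *)

(** * The reduced characteristic polynomials and their value at L^3 *)

Lemma nat_ind3 (P : nat -> Prop) :
  P 0%N -> P 1%N -> P 2 -> (forall n, P n -> P n.+2 -> P n.+3) -> forall n, P n.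
Proof.
move=> P0 P1 P2 PS n; suff [] : [/\ P n, P n.+1 & P n.+2] by [].
by elim: n => // n [Pn Pn1 Pn2]; split=> //; apply: PS.
Qed.

(* [redchar n] is the polynomial q_n with chi_n = X^(n %% 3) * q_n(X^3). *)
Fixpoint redchar (F : comNzRingType) (n : nat) : {poly F} :=
  match n with
  | S (S (S k) as l) => 'X ^+ (3 %| k)%N * redchar F l - redchar F k
  | _ => 1
  end.

(** In chi_(n+3) = x chi_(n+2) - chi_n the powers of x split off are x^(1 + (n+2) mod 3) and x^(n
    mod 3). They differ by x^3, the variable of q, if 3 divides n, and agree otherwise. *)
Lemma redcharS (F : comNzRingType) n :
  redchar F n.+3 = 'X ^+ (3 %| n)%N * redchar F n.+2 - redchar F n.
Proof. by []. Qed.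

Lemma size_monic_redchar (F : comNzRingType) n :
  redchar F n \is monic /\ size (redchar F n) = (n %/ 3).+1.
Proof.
elim/nat_ind3: n => [|||n [mon0 sz0] [mon2 sz2]].
1-3: by rewrite monic1 size_poly1.
have monX : 'X ^+ (3 %| n)%N * redchar F n.+2 \is monic.
  by rewrite monicMl // monicXn.
have szX : size ('X ^+ (3 %| n)%N * redchar F n.+2) = (n.+3 %/ 3).+1.
  rewrite size_Mmonic ?monic_neq0 ?monicXn // size_polyXn sz2.
  by case: (boolP (3 %| n)%N) => /=; lia.
have lt_sz : (size (- redchar F n) < size ('X ^+ (3 %| n)%N * redchar F n.+2)%R)%N.
  by rewrite size_polyN szX sz0; lia.
rewrite redcharS monicE lead_coefDl // size_polyDl //.
Qed.

(* The invariant is chi_(k+1)(L) >= 2^(1/3) chi_k(L), in terms of q. *)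
Lemma redchar_gt0 (F : realFieldType) n : 0 < (redchar F n).[27 / 4].
Proof.
pose y : F := 27 / 4; pose h k := (redchar F k).[y].
pose e k : F := y ^+ (3 %| k)%N.
(* The factor 2/3 is 2^(1/3) / L. At x = L the recurrence has characteristic polynomial z^3 - L z^2
   + 1, whose double root is 2^(1/3), so the bound on the ratios reproduces itself. *)
suff [h0 _ _] : [/\ 0 < h n, 2 / 3 * e n.+1 * h n <= h n.+1 &
              2 / 3 * e n.+2 * h n.+1 <= h n.+2] by exact: h0.
elim: n => [|n [h0 h1 h2]]; first by rewrite /h /e !hornerE /=; split; lra.
have hS : h n.+3 = e n.+3 * h n.+2 - h n.
  rewrite /h /e redcharS hornerD hornerN hornerM hornerXn.
  by congr (_ ^+ _ * _ - _); lia.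
have e3 k : 0 < e k by rewrite exprn_gt0 // /y; lra.
(* Exactly one of three consecutive integers is a multiple of 3. *)
have eee : e n.+1 * e n.+2 * e n.+3 = 27 / 4.
  rewrite /e -!exprD -[RHS]expr1; congr (_ ^+ _); lia.
have h1' : 0 < h n.+1 by apply: lt_le_trans h1; rewrite !mulr_gt0 ?invr_gt0.
split=> //.
(* Then [h n] takes away at most a third and leaves the required 2/3. The 3 is (2/3)^2 * 27/4, from
   the two ratio bounds. *)
suff le3 : 3 * h n <= e n.+3 * h n.+2.
  by rewrite hS -mulrA; move: (e n.+3 * h n.+2) le3 => z; lra.
have le1 : e n.+3 * (2 / 3 * e n.+2 * h n.+1) <= e n.+3 * h n.+2.
  by rewrite ler_pM2l.
have le2 : e n.+3 * e n.+2 * (2 / 3 * e n.+1 * h n) <= e n.+3 * e n.+2 * h n.+1.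
  by rewrite ler_pM2l // mulr_gt0.
have : 2 / 3 * (e n.+1 * e n.+2 * e n.+3) * h n <= e n.+3 * e n.+2 * h n.+1.
  by move: le2; lra.
by rewrite eee; move: le1; lra.
Qed.

(** * Interlacing of the roots *)

(** The first k factors are negative at x, the remaining ones positive. *)
Lemma sign_horner_prod (F : realFieldType) (t : nat -> F) m k x :
  (k <= m)%N -> (forall i, (i < k)%N -> x < t i) ->
  (forall i, (k <= i < m)%N -> t i < x) ->
  0 < (-1) ^+ k * (\prod_(i < m) ('X - (t i)%:P)).[x].
Proof.
elim: m k => [|m IHm] k le_k gt_t lt_t.
  by move: le_k; rewrite leqn0 => /eqP ->; rewrite big_ord0 hornerC mulr1 expr0 ltr01.
rewrite big_ord_recr hornerM hornerXsubC /=.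
have [le_km|] := leqP k m.
  rewrite mulrA mulr_gt0 ?subr_gt0 ?lt_t ?le_km ?ltnSn //.
  by apply: IHm => // i ki; apply: lt_t; lia.
move=> lt_mk; have -> : k = m.+1 by lia.
have tm : 0 < t m - x by rewrite subr_gt0; apply: gt_t.
have : 0 < (-1) ^+ m * (\prod_(i < m) ('X - (t i)%:P)).[x].
  apply: IHm => // i im; first by apply: gt_t; lia.
  by exfalso; lia.
by move=> /mulr_gt0 /(_ tm); rewrite exprS; congr (0 < _); ring.
Qed.

Lemma monic_prod_roots (F : fieldType) (p : {poly F}) m (t : nat -> F) :
  p \is monic -> size p = m.+1 ->
  (forall i j, (i < m)%N -> (j < m)%N -> t i = t j -> i = j) ->
  (forall i, (i < m)%N -> root p (t i)) ->
  p = \prod_(i < m) ('X - (t i)%:P).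
Proof.
move=> mon sz inj_t root_t.
have := @all_roots_prod_XsubC F p (map t (iota 0 m)).
rewrite size_map size_iota sz (monicP mon) scale1r => -> //.
- by rewrite big_map -[X in iota 0 X]subn0 big_mkord.
- by apply/allP => x; case/mapP => i; rewrite mem_iota => ? ->; apply: root_t; lia.
- rewrite uniq_rootsE map_inj_in_uniq ?iota_uniq // => i j.
  by rewrite !mem_iota => ? ?; apply: inj_t; lia.
Qed.

Lemma decr_lt (d : Order.disp_t) (F : porderType d) (u : nat -> F) n i j :
  (forall k, (k <= n)%N -> (u k.+1 < u k)%O) -> (i < j)%N -> (j <= n.+1)%N ->
  (u j < u i)%O.
Proof.
move=> dec; elim: j => // j IHj; rewrite ltnS leq_eqVlt => /predU1P[->|ij] jn.
  by apply: dec.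
by apply: lt_trans (IHj ij _); [apply: dec | lia].
Qed.

(* [u] merges the roots of the three polynomials in decreasing order, between
   the sentinels 27/4 and 0; outside [0, n + 1] its values are irrelevant. *)
Lemma redchar_interlacing (F : rcfType) n :
  exists u : nat -> F, [/\ u 0%N = 27 / 4, u n.+1 = 0,
    forall i, (i <= n)%N -> u i.+1 < u i &
    forall j, (j < 3)%N -> redchar F (n + 2 - j)
      = \prod_(k < (n + 2 - j) %/ 3) ('X - (u (3 * k + 1 + j)%N)%:P)].
Proof.
elim: n => [|n [u [u0 un dec fac]]].
  (* q_0 = q_1 = q_2 = 1 have no roots, so only the two sentinels are present. *)
  exists (fun i => if i is 0%N then 27 / 4 else 0); split=> //.
    by case=> //; lra.
  by case=> [|[|[|]]] //; rewrite divn_small // big_ord0.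
have gtu := decr_lt dec.
have u_ge0 i : (i <= n.+1)%N -> 0 <= u i.
  rewrite leq_eqVlt => /predU1P[->|lti]; first by rewrite un.
  by rewrite -un ltW // gtu.
(* Indices 1, 2, 0 mod 3 strictly between the sentinels carry the roots of q_(n+2), q_(n+1), q_n
   respectively. *)
have facA : redchar F n.+2 = \prod_(k < n.+2 %/ 3) ('X - (u (3 * k + 1)%N)%:P).
  have := fac 0%N isT; rewrite subn0 addn2 => ->.
  by apply: eq_bigr => k _; rewrite addn0.
have facC : redchar F n = \prod_(k < n %/ 3) ('X - (u (3 * k + 3)%N)%:P).
  have := fac 2%N isT; rewrite addnK => ->.
  by apply: eq_bigr => k _; rewrite -addnA.
(* For k > 0 this point is a root of q_n, so q_(n+3) has the sign of q_(n+2) there, and k roots of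
   q_(n+2) lie above it. *)
have sgnw k : (3 * k <= n)%N -> 0 < (-1) ^+ k * (redchar F n.+3).[u (3 * k)%N].
  case: k => [|k] le_k; first by rewrite expr0 mul1r u0 redchar_gt0.
  rewrite redcharS hornerD hornerN hornerM hornerXn.
  have -> : (redchar F n).[u (3 * k.+1)%N] = 0.
    have lt_k : (k < n %/ 3)%N by lia.
    rewrite facC horner_prod (bigD1 (Ordinal lt_k)) //=.
    by rewrite hornerXsubC (_ : 3 * k + 3 = 3 * k.+1)%N ?subrr ?mul0r //; lia.
  rewrite subr0 mulrCA mulr_gt0 ?exprn_gt0 //.
    by rewrite -un; apply: gtu; lia.
  rewrite facA; apply: (@sign_horner_prod _ (fun i => u (3 * i + 1)%N)) => [|i ik|i ik].
  - by lia.
  - by apply: gtu; lia.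
  - by apply: gtu; lia.
(* Here the first term of the recurrence vanishes, so q_(n+3) equals - q_n, and k roots of q_n lie
   above the point. *)
have sgnv k : (3 * k <= n)%N -> (-1) ^+ k * (redchar F n.+3).[u (3 * k + 1)%N] < 0.
  move=> le_k; rewrite redcharS hornerD hornerN hornerM hornerXn.
  have -> : u (3 * k + 1)%N ^+ (3 %| n)%N * (redchar F n.+2).[u (3 * k + 1)%N] = 0.
    have [lt_k|ge_k] := ltnP (3 * k) n.
      have lt_k3 : (k < n.+2 %/ 3)%N by lia.
      rewrite facA horner_prod (bigD1 (Ordinal lt_k3)) //=.
      by rewrite hornerXsubC subrr mul0r mulr0.
    (* When 3 k = n the point is the sentinel 0 and not a listed root of q_(n+2); the factor x of
       the recurrence vanishes instead. *)
    have -> : (3 * k + 1 = n.+1)%N by lia.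
    have -> : (3 %| n)%N by lia.
    by rewrite un mul0r.
  rewrite sub0r mulrN oppr_lt0 facC.
  apply: (@sign_horner_prod _ (fun i => u (3 * i + 3)%N)) => [|i ik|i ik].
  - by lia.
  - by apply: gtu; lia.
  - by apply: gtu; lia.
(* The new roots come from the intermediate value theorem. The default 0 serves as the new last
   sentinel when 3 divides n + 1. *)
have [d dP] : exists d : nat -> F, forall k, if (3 * k <= n)%N then
    [/\ u (3 * k + 1)%N < d k, d k < u (3 * k)%N & root (redchar F n.+3) (d k)]
    else d k = 0.
  have root_k k : {d | if (3 * k <= n)%N then
    [/\ u (3 * k + 1)%N < d, d < u (3 * k)%N & root (redchar F n.+3) d]
    else d = 0}.
    have [le_k|] := leqP (3 * k) n; last by exists 0.
    have lt_u : u (3 * k + 1)%N < u (3 * k)%N by apply: gtu; lia.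
    have [|d] := @poly_ivtoo _ (redchar F n.+3) _ _ (ltW lt_u).
      have := sgnw _ le_k; have := sgnv _ le_k.
      rewrite -signr_odd; case: odd; rewrite ?expr1 ?expr0 ?mul1r ?mulN1r; nra.
    by rewrite in_itv /= => /andP[d1 d2] rd; exists d.
  by exists (fun k => sval (root_k k)) => k; case: (root_k k).
(* All indices shift by one, and each [u (3 * k)] (a root of q_n, or a sentinel) is replaced by
   [d k]; thus q_(n+3), q_(n+2), q_(n+1) occupy the classes 1, 2, 0 mod 3. *)
pose v i := if i is i'.+1 then
  if (3 %| i')%N then d (i' %/ 3)%N else u i' else 27 / 4.
have vd k : v (3 * k + 1)%N = d k.
  by rewrite addn1 /v dvdn_mulr // mulKn.
have vu i : ~~ (3 %| i)%N -> v i.+1 = u i by rewrite /v => /negPf ->.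
have dec_v i : (i <= n.+1)%N -> v i.+1 < v i.
  have : (i = 3 * (i %/ 3) + i %% 3)%N by lia.
  have : (i %% 3 < 3)%N by lia.
  case: (i %% 3)%N => [_|[_|[_|//]]]; move: (i %/ 3)%N => k -> le_k.
  - rewrite -addn1 addn0 vd; move: (dP k); case: leqP => [_ [_ lt_d _]|gt_k ->].
      case: k le_k lt_d => [|k] le_k; first by rewrite u0.
      move=> /lt_trans; apply; rewrite (_ : 3 * k.+1 = (3 * k + 2).+1)%N; last by lia.
      by rewrite vu; [apply: gtu; lia | lia].
    rewrite (_ : 3 * k = (3 * k).-1.+1)%N; last by lia.
    by rewrite vu -?un; [apply: gtu; lia | lia].
  - rewrite vd vu; last by lia.
    by move: (dP k); rewrite (_ : 3 * k <= n)%N; [case | lia].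
  - rewrite vu; last by lia.
    rewrite (_ : 3 * k + 2 = (3 * k + 1).+1)%N; last by lia.
    by rewrite vu; [apply: gtu; lia | lia].
exists v; split=> //.
  have := boolP (3 %| n.+1)%N; case => [dvd3|ndvd]; last by rewrite vu.
  move: (dP (n.+1 %/ 3)%N); rewrite /v dvd3.
  by have -> : (3 * (n.+1 %/ 3) <= n)%N = false by lia.
move=> j lt_j; have [j0|jgt0] := posnP j.
  rewrite j0 subn0 addn2.
  (* The n / 3 + 1 distinct roots [d k] exhaust the degree of q_(n+3). *)
  have [mon sz] := size_monic_redchar F n.+3.
  have -> := monic_prod_roots mon sz (t := fun k => v (3 * k + 1)%N).
  - by apply: eq_bigr => k _; rewrite addn0.
  - move=> i k lti ltk eqv; apply/eqP; case: ltngtP => // lt_ik.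
    + have := decr_lt dec_v (_ : 3 * i + 1 < 3 * k + 1)%N.
      by rewrite eqv ltxx => /(_ _ _)/implyP; lia.
    + have := decr_lt dec_v (_ : 3 * k + 1 < 3 * i + 1)%N.
      by rewrite eqv ltxx => /(_ _ _)/implyP; lia.
  - move=> k lt_k; rewrite vd; move: (dP k).
    by rewrite (_ : 3 * k <= n)%N; [case | lia].
have := fac j.-1 _; rewrite (_ : n + 2 - j.-1 = n.+1 + 2 - j)%N; last by lia.
move=> ->; last by lia.
apply: eq_bigr => k _; rewrite (_ : 3 * k + 1 + j = (3 * k + j).+1)%N; last by lia.
by rewrite vu; [congr ('X - (u _)%:P); lia | lia].
Qed.

(** * The characteristic polynomial as a band determinant, and the kernel *)

Definition band_entry (A : comNzRingType) (x : A) (i j : nat) : A :=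
  if i == j then x else if (j == i.+1) || (i == j.+2) then -1 else 0.

(** This is x I - T_n(a). Natural-number indices let the entries of its minors reduce by
    computation. *)
Definition band (A : comNzRingType) (x : A) n : 'M[A]_n :=
  \matrix_(i, j) band_entry x i j.

Lemma det_row_single (A : comPzRingType) n (M : 'M[A]_n) i k :
  (forall j, j != k -> M i j = 0) -> \det M = M i k * cofactor M i k.
Proof.
move=> M0; rewrite (expand_det_row _ i) (bigD1 k) //= big1 ?addr0 // => j jk.
by rewrite M0 ?mul0r.
Qed.

Lemma det_band_rec (A : comNzRingType) (x : A) n :
  \det (band x n.+3) = x * \det (band x n.+2) - \det (band x n).
Proof.
rewrite (expand_det_row _ ord0) (bigD1 ord0) //= (bigD1 (lift ord0 ord0)) //=.
rewrite big1 ?addr0 => [|[[|[|j]] lt_j] // _]; last first.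
  by rewrite mxE /band_entry /= mul0r.
rewrite !mxE /band_entry /= mulN1r /cofactor expr0 expr1 mul1r mulN1r opprK.
congr (x * \det _ + _); first by apply/matrixP => i j; rewrite !mxE.
(* The first column of this minor keeps only the -1 from row 2 of the band matrix. *)
set N := row' _ _; rewrite -[\det N]det_tr (@det_row_single _ _ _ ord0 (lift ord0 ord0)); last first.
  by case=> [[|[|j]] lt_j] // _; rewrite !mxE.
rewrite !mxE /band_entry /= mulN1r; congr (- _).
rewrite /cofactor expr1 mulN1r.
(* Row 1 of the band matrix, without columns 0 and 1, keeps only its -1 in column 2. *)
set P := row' _ _; rewrite -[\det P]det_tr (@det_row_single _ _ _ ord0 ord0); last first.
  by case=> [[|j] lt_j] // _; rewrite !mxE.
rewrite !mxE /band_entry /= mulN1r opprK /cofactor expr0 mul1r.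
by congr (\det _); apply/matrixP => i j; rewrite !mxE.
Qed.

Lemma char_poly_Ta (R : realType) n :
  char_poly (Ta R n) = \det (band 'X n).
Proof.
congr (\det _); apply/matrixP => i j; rewrite !mxE /band_entry /acoef.
rewrite -val_eqE /=; case: eqVneq => [->|neq_ij].
  by rewrite subrr /= subr0.
rewrite mulr0n sub0r.
have -> : ((i%:Z - j%:Z == -1) || (i%:Z - j%:Z == 2)) = ((j == i.+1 :> nat) || (i == j.+2 :> nat)).
  by lia.
by case: ifP => _; rewrite ?polyC0 ?oppr0.
Qed.

Lemma det_band_redchar (F : comNzRingType) n :
  \det (band ('X : {poly F}) n) = 'X ^+ (n %% 3) * (redchar F n \Po 'X^3).
Proof.
elim/nat_ind3: n => [|||n D0 D2].
- by rewrite /= comp_polyC !mulr1; exact: det_mx00.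
- by rewrite /= comp_polyC mulr1 det_mx11 mxE.
- rewrite /= comp_polyC mulr1 (@det_row_single _ _ _ ord_max ord_max).
    by rewrite /cofactor det_mx11 !mxE /= -signr_odd /= expr0 mul1r.
  by case=> [[|[|j]] lt_j] // _; rewrite mxE.
rewrite det_band_rec D2 D0 redcharS comp_polyB comp_polyM comp_Xn_poly.
rewrite -exprM mulrBr !mulrA -exprS -exprD.
by congr ('X ^+ _ * _ - 'X ^+ _ * _); lia.
Qed.

(* A vector killed by T_n satisfies v_(j-1) = - v_(j+2), so it is determined by
   its last coordinate. *)
Lemma geomult_Ta0_le1 (R : realType) n : (0 < n)%N ->
  (geomult (Ta R n) 0 <= 1)%N.
Proof.
case: n => // n _; rewrite /geomult /eigenspace raddf0 subr0.
set K := kermx _; pose e : 'cV[R[i]]_n.+1 := delta_mx ord_max ord0.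
(* [K *m e] has one column, so the rank of K is at most 1 once the last coordinate is injective on
   K. *)
suff : \rank (K :&: kermx e) == 0%N.
  by move/eqP=> rk0; rewrite -(mxrank_mul_ker K e) rk0 addn0 rank_leq_col.
rewrite mxrank_eq0 -submx0; apply/row_subP => i.
set v := row i _.
have vT : v *m Ta R n.+1 = 0.
  by apply/sub_kermxP; apply: submx_trans (row_sub i _) (capmxSl _ _).
have ve : v *m e = 0.
  by apply/sub_kermxP; apply: submx_trans (row_sub i _) (capmxSr _ _).
move: v vT ve => v vT ve.
rewrite submx0; apply/eqP/rowP => j; rewrite [RHS]mxE.
have v_last : v ord0 ord_max = 0.
  move/matrixP/(_ ord0 ord0): ve; rewrite mxE [in RHS]mxE (bigD1 ord_max) //= big1.
    by rewrite mxE !eqxx mulr1 addr0.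
  by move=> k /negPf nk; rewrite mxE nk mulr0.
suff v0 k : forall j : 'I_n.+1, (n - j <= k)%N -> v ord0 j = 0 by apply: (v0 n); lia.
elim: k => [|k IHk] {}j le_j.
  by rewrite (_ : j = ord_max) //; apply/val_inj => /=; have := ltn_ord j; lia.
have [jn|ltjn] := eqVneq (j : nat) n; first by apply: IHk; rewrite jn subnn.
have lt_j1 : (j.+1 < n.+1)%N by have := ltn_ord j; lia.
move/matrixP/(_ ord0 (Ordinal lt_j1)): vT; rewrite mxE [in RHS]mxE (bigD1 j) //= big1.
  rewrite addr0 /Ta /toeplitz mxE /acoef.
  by rewrite (_ : (j%:Z - j.+1%:Z == -1) = true) ?mulr1 //=; lia.
move=> l lj; rewrite /Ta /toeplitz mxE /acoef /=.
have [l3|nl3] := eqVneq (l : nat) j.+3; first by rewrite IHk ?mul0r // l3; lia.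
case: ifP => [|_]; last by rewrite mulr0.
by move: lj nl3; rewrite -val_eqE /=; lia.
Qed.

(** * Roots of the reduced polynomials *)

Lemma map_redchar (F G : comNzRingType) (f : {rmorphism F -> G}) n :
  map_poly f (redchar F n) = redchar G n.
Proof.
elim/nat_ind3: n => [|||n D0 D2].
1-3: by rewrite rmorph1.
by rewrite !redcharS rmorphB rmorphM rmorphXn /= map_polyX D0 D2.
Qed.

Lemma redchar_factor (F : rcfType) n : (2 <= n)%N ->
  exists t : nat -> F,
    [/\ forall k, (k < n %/ 3)%N -> 0 < t k < 27 / 4,
        forall i j, (i < n %/ 3)%N -> (j < n %/ 3)%N -> t i = t j -> i = j
      & redchar F n = \prod_(k < n %/ 3) ('X - (t k)%:P)].
Proof.
(* The interlacing at n lists the roots of q_(n+2), hence the shift by 2. *)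
case: n => [|[|n]] // _; have [u [u0 un /decr_lt dec fac]] := redchar_interlacing F n.
exists (fun k => u (3 * k + 1)%N); split=> [k lt_k|i j lt_i lt_j eqt|].
- by rewrite -un -u0 !dec //; lia.
- apply/eqP; case: ltngtP => // lt_ij.
    by have := dec (3 * i + 1)%N (3 * j + 1)%N; rewrite eqt ltxx; lia.
  by have := dec (3 * j + 1)%N (3 * i + 1)%N; rewrite eqt ltxx; lia.
- have := fac 0%N isT; rewrite subn0 addn2 => ->.
  by apply: eq_bigr => k _; rewrite addn0.
Qed.

(** * Cube roots of unity and real cube roots *)

Local Open Scope complex_scope.

Lemma cexpiD (R : realType) (a b : R) : cexpi (a + b) = cexpi a * cexpi b.
Proof. by rewrite /cexpi cosD sinD [sin a * _ + _]addrC. Qed.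

Lemma eps3_cube (R : realType) : eps3 R ^+ 3 = 1.
Proof.
rewrite /eps3 !exprS expr0 mulr1 -!cexpiD.
have -> : 2 * pi / 3 + (2 * pi / 3 + 2 * pi / 3) = pi *+ 2 :> R by field.
by rewrite /cexpi cos2pi sin2pi.
Qed.

(** eps is a root of x^3 - 1 and differs from 1, since its imaginary part sin(2 pi / 3) is
    positive. *)
Lemma eps3_sum (R : realType) : eps3 R ^+ 2 + eps3 R + 1 = 0.
Proof.
have : (eps3 R - 1) * (eps3 R ^+ 2 + eps3 R + 1) = eps3 R ^+ 3 - 1 by ring.
rewrite eps3_cube subrr => /eqP; rewrite mulf_eq0 => /orP[|/eqP //].
rewrite subr_eq0 => /eqP /(congr1 (@complex.Im R)) /= => sin0.
have : 0 < sin (2 * pi / 3 : R).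
  by apply: sin_gt0_pi; have := pi_gt0 R; move=> ?; lra.
by rewrite sin0 ltxx.
Qed.

Lemma eps3X_cube (R : realType) p : (eps3 R ^+ p) ^+ 3 = 1.
Proof. by rewrite exprAC eps3_cube expr1n. Qed.

(** Stated over a ring so as to apply both to numbers and to polynomials. *)
Lemma sub_cube_factor (A : comNzRingType) (w z x : A) : w ^+ 2 + w + 1 = 0 ->
  z ^+ 3 - x ^+ 3 = (z - x) * ((z - w * x) * (z - w ^+ 2 * x)).
Proof.
move=> w0; have w2 : w ^+ 2 = - w - 1.
  by apply/eqP; rewrite -subr_eq0 -w0; apply/eqP; ring.
transitivity ((z - x) * (z ^+ 2 + z * x - (w ^+ 2 + w) * x ^+ 2)).
  by rewrite w2; ring.
by rewrite w2; ring: w2.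
Qed.

Lemma cube_eq_eps3 (R : realType) (z x : R[i]) : z ^+ 3 = x ^+ 3 ->
  exists2 p, (p < 3)%N & z = eps3 R ^+ p * x.
Proof.
move/eqP; rewrite -subr_eq0 (sub_cube_factor z x (eps3_sum R)) !mulf_eq0 !subr_eq0.
case/or3P => /eqP ->; first by exists 0%N; rewrite ?mul1r.
- by exists 1%N.
- by exists 2%N.
Qed.

Lemma powR_cbrtK (R : realType) (x : R) : 0 <= x -> (x `^ 3^-1) ^+ 3 = x.
Proof.
move=> x_ge0.
by rewrite -powR_mulrn ?powR_ge0 // -powRrM mulVf ?pnatr_eq0 // powRr1.
Qed.

Lemma Lend_cube (R : realType) : Lend R ^+ 3 = 27 / 4.
Proof. by rewrite /Lend expr_div_n powR_cbrtK //; congr (_ / _); ring. Qed.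

Lemma Lend_gt0 (R : realType) : 0 < Lend R.
Proof. by rewrite divr_gt0 ?powR_gt0. Qed.

(** * From the roots of q_n to eigenvalues and multiplicities *)

Lemma char_poly_Ta_factor (R : realType) n : (2 <= n)%N ->
  exists s : nat -> R,
    [/\ forall k, (k < n %/ 3)%N -> 0 < s k < Lend R,
        forall i j, (i < n %/ 3)%N -> (j < n %/ 3)%N -> s i = s j -> i = j
      & char_poly (Ta R n) =
          'X ^+ (n %% 3) * \prod_(k < n %/ 3) ('X^3 - ((s k)%:C ^+ 3)%:P)].
Proof.
move=> /(redchar_factor R) [t [t_bnd t_inj facq]].
(* For real cube roots, t < 27/4 = L^3 becomes s < L. *)
pose s k := t k `^ 3^-1.
have s3 k : (k < n %/ 3)%N -> s k ^+ 3 = t k.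
  by move=> /t_bnd /andP[/ltW t_ge0 _]; apply: powR_cbrtK.
exists s; split=> [k lt_k|i j lt_i lt_j eqs|].
- have /andP[t_gt0 lt_t] := t_bnd k lt_k; rewrite powR_gt0 //=.
  rewrite -(@ltr_pXn2r _ 3) ?nnegrE ?powR_ge0 ?ltW ?Lend_gt0 //.
  by rewrite [X in X < _](s3 k lt_k) Lend_cube.
- by apply: t_inj => //; rewrite -!s3 // eqs.
rewrite char_poly_Ta det_band_redchar -(map_redchar (real_complex R)) facq.
rewrite !rmorph_prod; congr (_ * _); apply: eq_bigr => k _ /=.
by rewrite map_polyXsubC comp_polyB comp_polyX comp_polyC -s3 // rmorphXn.
Qed.


Lemma realC_cube_inj (R : realType) (x y : R) : 0 <= x -> 0 <= y ->
  x%:C ^+ 3 = y%:C ^+ 3 :> R[i] -> x = y.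
Proof.
move=> x0 y0; rewrite -!rmorphXn => /complexI /eqP.
by rewrite eqrXn2 // => /eqP.
Qed.

Lemma root_prod_cubes (F : fieldType) m (c : nat -> F) (z : F) :
  reflect (exists2 k, (k < m)%N & z ^+ 3 = c k)
    (root (\prod_(k < m) ('X^3 - (c k)%:P)) z).
Proof.
rewrite rootE horner_prod; apply: (iffP (prodf_eq0 _ _)) => /=.
  move=> [k _]; rewrite !hornerE subr_eq0 => /eqP zk.
  by exists k.
by move=> [k lt_k zk]; exists (Ordinal lt_k); rewrite // !hornerE zk subrr.
Qed.

(** As the c_i are distinct, z is a root of one factor only, and that factor splits as (x - z)(x -
    eps z)(x - eps^2 z) with z different from the other two roots. *)
Lemma mup_prod_cubes (R : realType) m (c : nat -> R[i]) k (z : R[i]) :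
  (forall i j, (i < m)%N -> (j < m)%N -> c i = c j -> i = j) ->
  (k < m)%N -> z ^+ 3 = c k -> z != 0 ->
  mup z (\prod_(k < m) ('X^3 - (c k)%:P)) = 1%N.
Proof.
move=> c_inj lt_k zk z0; rewrite (bigD1 (Ordinal lt_k)) //= mupMl; last first.
  rewrite rootE horner_prod; apply/prodf_neq0 => i neq_ik.
  rewrite !hornerE subr_eq0 zk; apply: contraNneq neq_ik => /c_inj eq_ik.
  by apply/eqP/val_inj; rewrite /= eq_ik.
have eps_neq : (eps3 R != 1) && (eps3 R ^+ 2 != 1).
  have e3 := eps3_sum R; have c3 := eps3_cube R.
  rewrite -negb_or; apply/negP.
  have ne1 : eps3 R <> 1.
    move=> e1; have /eqP : 3%:R = 0 :> R[i] by rewrite -e3 e1; ring.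
    by rewrite pnatr_eq0.
  case/orP => /eqP // e2; apply: ne1.
  by rewrite -[LHS]mulr1 -e2 -exprS c3.
have -> : 'X^3 - (c k)%:P = ('X - z%:P) ^+ 1 *
    (('X - (eps3 R * z)%:P) * ('X - (eps3 R ^+ 2 * z)%:P)).
  have w0 : (eps3 R)%:P ^+ 2 + (eps3 R)%:P + 1 = 0 :> {poly R[i]}.
    by rewrite -polyC_exp -polyC1 -!polyCD eps3_sum.
  by rewrite -zk polyC_exp (sub_cube_factor _ _ w0) expr1 !polyCM.
rewrite mupMl ?mup_XsubCX ?eqxx //.
case/andP: eps_neq => e1 e2.
rewrite rootM !root_XsubC negb_or -{1 3}[z]mul1r.
by rewrite !(inj_eq (mulIf z0)) eq_sym e1 eq_sym e2.
Qed.

(** * The spectrum of T_n(a) *)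

Theorem theorem1p1 (R : realType) (n m r : nat)
    (hn : (3 <= n)%N) (hr : (r < 3)%N) (hnmr : n = (3 * m + r)%N) :
  [/\ spectrum (Ta R n) `<=` Lambda R,
      zset (eps3 R) (spectrum (Ta R n)) = spectrum (Ta R n),
      forall p : nat, (p < 3)%N ->
        (spectrum (Ta R n) `&` zset (eps3 R ^+ p) (copen_seg R)) #= `I_m /\
        (forall z : R[i], spectrum (Ta R n) z ->
           zset (eps3 R ^+ p) (copen_seg R) z -> algmult (Ta R n) z = 1%N)
    & ~~ (3 %| n)%N ->
        [/\ spectrum (Ta R n) 0, algmult (Ta R n) 0 = r
          & geomult (Ta R n) 0 = 1%N]].
Proof.
have [|s [s_bnd s_inj charE]] := @char_poly_Ta_factor R n; first by lia.
have mE : (n %/ 3 = m)%N by lia.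
have rE : (n %% 3 = r)%N by lia.
rewrite {}mE {}rE in s_bnd s_inj charE.
have s_gt0 k : (k < m)%N -> 0 < s k by move=> /s_bnd /andP[].
have s3_inj i j : (i < m)%N -> (j < m)%N ->
    (s i)%:C ^+ 3 = (s j)%:C ^+ 3 :> R[i] -> i = j.
  move=> lt_i lt_j eqs; apply: s_inj => //.
  by apply: realC_cube_inj eqs; rewrite ltW ?s_gt0.
have sC_neq0 k : (k < m)%N -> (s k)%:C != 0 :> R[i].
  by move=> lt_k; rewrite fmorph_eq0 gt_eqF ?s_gt0.
have rootP z := root_prod_cubes m (fun k => (s k)%:C ^+ 3) z.
have specP z : spectrum (Ta R n) z <->
    ((0 < r)%N /\ z = 0) \/ (exists2 k, (k < m)%N & z ^+ 3 = (s k)%:C ^+ 3).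
  rewrite /spectrum /= eigenvalue_root_char charE rootM rootE hornerXn expf_eq0.
  split.
    case/orP => [/andP[-> /eqP ->]|/rootP]; first by left.
    by right.
  move=> [[-> ->]|/rootP ->]; first by rewrite eqxx.
  by rewrite orbT.
have spec_neq0 z : spectrum (Ta R n) z -> z != 0 ->
    exists2 k, (k < m)%N & z ^+ 3 = (s k)%:C ^+ 3.
  by move=> /specP [[_ ->]|//]; rewrite eqxx.
have eps_neq0 p : eps3 R ^+ p != 0.
  apply/eqP => e0; have := eps3X_cube R p; rewrite e0 expr0n /= => /eqP.
  by rewrite eq_sym oner_eq0.
have seg_neq0 p z : zset (eps3 R ^+ p) (copen_seg R) z -> z != 0.
  move=> [_ [x /= x_itv <-] <-].
  move: x_itv; rewrite in_itv /= => /andP[x_gt0 _].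
  by rewrite mulf_neq0 // fmorph_eq0 gt_eqF.
split.
- move=> z /specP[[_ ->]|[k lt_k /cube_eq_eps3[p lt_p ->]]].
    left; left; exists 0; rewrite ?rmorph0 //=.
    by rewrite in_itv /= lexx ltW ?Lend_gt0.
  have /andP[/ltW s_ge0 /ltW s_le] := s_bnd k lt_k.
  have seg : cclosed_seg R (s k)%:C by exists (s k); rewrite //= in_itv /= s_ge0.
  case: p lt_p => [|[|[|//]]] _.
  + by left; left; rewrite mul1r.
  + by left; right; exists (s k)%:C; rewrite // expr1.
  + by right; exists (s k)%:C.
- apply/seteqP; split=> z.
    move=> [w /specP spec_w <-]; apply/specP; case: spec_w => [[r0 ->]|[k lt_k wk]].
      by left; rewrite mulr0.
    by right; exists k; rewrite // exprMn eps3_cube mul1r.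
  (* Multiplication by eps^2 inverts the rotation by eps. *)
  move=> /specP spec_z; exists (eps3 R ^+ 2 * z); last first.
    by rewrite mulrA -exprS eps3_cube mul1r.
  apply/specP; case: spec_z => [[r0 ->]|[k lt_k zk]]; first by left; rewrite mulr0.
  by right; exists k; rewrite // exprMn eps3X_cube mul1r.
- move=> p lt_p; split; last first.
    move=> z spec_z /seg_neq0 z0; have [k lt_k zk] := spec_neq0 z spec_z z0.
    rewrite /algmult charE mupMr; last by rewrite rootE hornerXn expf_neq0.
    exact: mup_prod_cubes s3_inj lt_k zk z0.
  (* Cubing removes eps^p, and positive reals are determined by their cubes. *)
  have -> : spectrum (Ta R n) `&` zset (eps3 R ^+ p) (copen_seg R) =
      [set eps3 R ^+ p * (s k)%:C | k in `I_m].
    apply/seteqP; split=> z.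
      move=> [spec_z seg_z]; have [k lt_k] := spec_neq0 z spec_z (seg_neq0 p z seg_z).
      move: seg_z => [_ [x /= x_itv <-] <-]; rewrite exprMn eps3X_cube mul1r.
      move: x_itv; rewrite in_itv /= => /andP[x_gt0 _] xk; exists k => //.
      by congr (_ * _%:C); symmetry; apply: realC_cube_inj xk; rewrite ltW ?s_gt0.
    move=> [k lt_k <-]; split.
      by apply/specP; right; exists k; rewrite // exprMn eps3X_cube mul1r.
    by exists (s k)%:C => //; exists (s k); rewrite //= in_itv /= s_bnd.
  apply: inj_card_eq => i j; rewrite !inE => lt_i lt_j /(mulfI (eps_neq0 p)).
  by move/complexI; apply: s_inj.
- move=> ndvd; have r_gt0 : (0 < r)%N by lia.
  have spec0 : spectrum (Ta R n) 0 by apply/specP; left.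
  split=> //.
    (* The cubic factors do not vanish at 0, so x^r alone gives the multiplicity. *)
    rewrite /algmult charE mupMl; first by rewrite -['X]subr0 mup_XsubCX eqxx.
    apply/negP => /rootP [k lt_k] /eqP.
    by rewrite expr0n /= eq_sym expf_eq0 (negPf (sC_neq0 k lt_k)).
  apply/eqP; rewrite eqn_leq geomult_Ta0_le1 /=; last by lia.
  by rewrite lt0n mxrank_eq0; exact: spec0.
Qed.
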